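(* Let $G$ be a plane graph with even polygonal faces. Let $\chi_f(G)$ be the maximum integer $k$ such that $G$ admits a half-monochromatic $k$-coloring, and let $\alpha(G)$ be the independence number of $G$. Then $\chi_f(G) \le \frac{3}{2}\alpha(G)$.
   Context: All colorings are proper: adjacent vertices receive distinct colors. A $k$-coloring uses exactly $k$ colors. A plane graph $G$ is a plane graph with even polygonal faces if every face of $G$ is bounded by a cycle of even length. A (proper) coloring of such a $G$ is half-monochromatic if, for every face $f$ of $G$, half of the vertices incident with $f$ receive the same color (i.e., if the boundary of $f$ has $2n$ vertices, some $n$ of them share one color). $\alpha(G)$ is the maximum size of an independent set of vertices of $G$. *)

(* Defs.v *)
From mathcomp Require Import all_boot fingroup perm.
Set Implicit Arguments.
Unset Strict Implicit.
Unset Printing Implicit Defensive.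

Record sgraph := SGraph {
  vertex :> finType;
  adj : rel vertex;
  adj_sym : symmetric adj;
  adj_irrefl : irreflexive adj }.

Definition edges (G : sgraph) : {set {set G}} :=
  [set [set p.1; p.2] | p : G * G & adj p.1 p.2].

Definition independent (G : sgraph) (S : {set G}) : bool :=
  [forall x in S, forall y in S, ~~ adj x y].

Definition alpha (G : sgraph) : nat :=
  \max_(S : {set G} | independent S) #|S|.

(* A dart is an edge with an orientation: (x, y) is the edge xy, directed     *)
(* from x to y.                                                               *)
Definition dart (G : sgraph) : finType := {d : G * G | adj d.1 d.2}.

Definition origin (G : sgraph) (d : dart G) : G := (val d).1.

Lemma adj_swap (G : sgraph) (d : dart G) : adj (val d).2 (val d).1.
Proof. by rewrite adj_sym (valP d). Qed.

Definition dart_rev (G : sgraph) (d : dart G) : dart G :=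
  exist (fun p : G * G => adj p.1 p.2) ((val d).2, (val d).1) (adj_swap d).

(* Plane graphs are given by their combinatorial embedding in the sphere:     *)
(* [rotation] lists, in cyclic order, the darts leaving each vertex; a face   *)
(* is traced by following a dart to its end and turning to the next dart      *)
(* there. A connected rotation system is an embedding in the sphere (that is, *)
(* in the plane, the choice of the outer face being irrelevant here) exactly  *)
(* when it satisfies Euler's formula |V| - |E| + |F| = 2. A plane graph all   *)
(* of whose faces are bounded by cycles is connected and has an edge, so      *)
(* nothing is lost in considering only such graphs.                           *)
Definition face_step (G : sgraph) (rot : {perm dart G}) (d : dart G) : dart G :=
  rot (dart_rev d).

Record plane_graph := PlaneGraph {
  underlying :> sgraph;
  rotation : {perm dart underlying};
  rotationP : forall d d' : dart underlying,
    (d' \in porbit rotation d) = (origin d' == origin d);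
  plane_connected : forall x y : underlying, connect (@adj underlying) x y;
  plane_Euler :
    #|underlying| + fcard (face_step rotation) (dart underlying)
      = #|edges underlying| + 2 }.

(* The face to which the dart d belongs, as the closed walk of its vertices.  *)
Definition face_walk (G : plane_graph) (d : dart G) : seq G :=
  [seq origin d' | d' <- orbit (face_step (rotation G)) d].

Definition is_cycle (G : sgraph) (s : seq G) : bool :=
  (2 < size s) && ucycleb (@adj G) s.

Definition even_polygonal_faces (G : plane_graph) : Prop :=
  forall d : dart G, is_cycle (face_walk d) /\ ~~ odd (size (face_walk d)).

Definition face_vertices (G : plane_graph) (d : dart G) : {set G} :=
  [set x in face_walk d].

Definition proper_coloring (G : sgraph) (k : nat) (c : {ffun G -> 'I_k}) : bool :=
  [forall x, forall y, adj x y ==> (c x != c y)].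

Definition uses_all_colors (G : sgraph) (k : nat) (c : {ffun G -> 'I_k}) : bool :=
  [forall i : 'I_k, exists x : G, c x == i].

Definition half_monochromatic (G : plane_graph) (k : nat)
    (c : {ffun G -> 'I_k}) : bool :=
  [forall d : dart G, exists i : 'I_k,
     #|face_vertices d|./2 <= #|[set x in face_vertices d | c x == i]|].

Definition has_half_mono_coloring (G : plane_graph) (k : nat) : bool :=
  [exists c : {ffun G -> 'I_k},
     [&& proper_coloring c, uses_all_colors c & half_monochromatic c]].

(* A coloring using all of its k colors has k <= |V|, so the range of the     *)
(* maximum contains every relevant k: see [leq_chi_f].                        *)
Definition chi_f (G : plane_graph) : nat :=
  \max_(k < #|G|.+1 | has_half_mono_coloring G k) k.

Lemma leq_chi_f (G : plane_graph) (k : nat) :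
  has_half_mono_coloring G k -> k <= chi_f G.
Proof.
move=> hk; have ltk : k < #|G|.+1.
  case/existsP: (hk) => c /and3P[_ /forallP allc _].
  rewrite ltnS -[k in k <= _]card_ord.
  apply: leq_trans (leq_image_card c predT).
  apply/subset_leq_card/subsetP => i _.
  by have /existsP[x /eqP <-] := allc i; apply/imageP; exists x.
exact: (@leq_bigmax_cond _ (fun j : 'I_#|G|.+1 => has_half_mono_coloring G j)
  (fun j => j : nat) (Ordinal ltk)).
Qed.

(* Main.v *)
Require Import Defs.
From mathcomp Require Import all_boot fingroup perm all_order all_algebra.
From mathcomp Require Import zify lra.
Set Implicit Arguments.
Unset Strict Implicit.
Unset Printing Implicit Defensive.
Local Open Scope ring_scope.

Import GRing.Theory Num.Theory.

(** The vertices whose color is used nowhere else form an independent set [S]: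
    an edge lies on a face of length at least 4, half of which has one color;
    by properness, pairing up the vertices along the face, that color occurs
    both at an end of the edge and at another vertex. Since every color outside
    [S] is used at least twice, 2k <= |V| + |S| <= |V| + alpha.

    It remains that |V| <= 2 alpha, because G is bipartite. Work with cochains
    over F_2, viewed as functions on darts. As the graph and its dual are
    connected, coboundaries of vertex functions have dimension |V| - 1, and
    symmetric functions summing to 0 over every face have dimension
    |E| - (|F| - 1). By Euler's formula these two spaces coincide, and the
    constant 1 belongs to the second one when all faces are even. *)

(** * Linear algebra: fiber matrices, ranks and exactness *)

Section FiberMatrix.
Variables (K : fieldType) (D X : finType) (p : D -> X).

(** Incidence matrix of [p]: it pulls functions on [X] back to [D], and its transpose sums functions
    on [D] over the fibers. *)
Definition fiber_mx : 'M[K]_(#|X|, #|D|) :=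
  \matrix_(i, j) (p (enum_val j) == enum_val i)%:R.

Lemma mul_fiber_mx m (u : 'M[K]_(m, #|X|)) i j :
  (u *m fiber_mx) i j = u i (enum_rank (p (enum_val j))).
Proof.
rewrite mxE (bigD1 (enum_rank (p (enum_val j)))) //= mxE enum_rankK eqxx mulr1.
rewrite big1 ?addr0 // => k nk; rewrite mxE.
case: eqP => [E|_]; last by rewrite mulr0.
by rewrite E enum_valK eqxx in nk.
Qed.

Lemma mul_fiber_mxT m (w : 'M[K]_(m, #|D|)) i j :
  (w *m fiber_mx^T) i j = \sum_(d | p d == enum_val j) w i (enum_rank d).
Proof.
rewrite mxE [RHS]big_mkcond (reindex (fun k : 'I_#|D| => enum_val k)) /=; last first.
  by apply: onW_bij; exact: enum_val_bij.
apply: eq_bigr => k _; rewrite !mxE enum_valK.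
by case: eqP => _; rewrite ?mulr1 ?mulr0.
Qed.

End FiberMatrix.

Lemma mxrank_ker_line (K : fieldType) m n (A : 'M[K]_(m, n)) (v : 'rV[K]_m) :
  (forall u : 'rV[K]_m, u *m A = 0 -> (u <= v)%MS) -> (m <= (\rank A).+1)%N.
Proof.
move=> kerA; have /mxrankS : (kermx A <= v)%MS.
  apply/row_subP => i; apply: kerA.
  by rewrite -row_mul mulmx_ker row0.
by rewrite mxrank_ker => /leq_trans/(_ (rank_leq_row v)); lia.
Qed.

(** The row space of [C] lies in the kernel of [M^T], whose dimension is [d - \rank M <= d - (n - 1)
    <= m - 1 <= \rank C], so the two spaces are equal. *)
Lemma exact_of_rank (K : fieldType) m n d (C : 'M[K]_(m, d)) (M : 'M[K]_(n, d))
    (w : 'rV[K]_d) :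
  C *m M^T = 0 -> (m <= (\rank C).+1)%N -> (n <= (\rank M).+1)%N ->
  (d + 2 <= m + n)%N -> w *m M^T = 0 -> (w <= C)%MS.
Proof.
move=> CM rC rM dim wM.
have CK : (C <= kermx M^T)%MS by apply/sub_kermxP.
have wK : (w <= kermx M^T)%MS by apply/sub_kermxP.
apply: submx_trans wK _; rewrite -(geq_leqif (mxrank_leqif_sup CK)).
by rewrite mxrank_ker mxrank_tr; lia.
Qed.

(** * Darts, edges and faces of the embedding *)

Section Bipartite.
Variable G : plane_graph.
Hypothesis even_faces : forall d : dart G, ~~ odd (size (face_walk d)).

Local Notation rot := (rotation G).
Local Notation phi := (face_step (rotation G)).

Definition edge_of (d : dart G) : {set G} := [set origin d; origin (dart_rev d)].

Lemma dart_revK : involutive (@dart_rev G).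
Proof. by move=> d; apply: val_inj; rewrite /= -surjective_pairing. Qed.

Lemma face_step_inj : injective phi.
Proof. by move=> d d' /perm_inj /(can_inj dart_revK). Qed.

Lemma origin_face_step (d : dart G) : origin (phi d) = origin (dart_rev d).
Proof.
by apply/eqP; rewrite -rotationP; have := mem_porbit rot 1 (dart_rev d); rewrite expg1.
Qed.

Lemma edge_of_mem (d : dart G) : edge_of d \in edges G.
Proof. by apply/imsetP; exists (val d) => //; rewrite inE (valP d). Qed.

Lemma edge_of_rev (d : dart G) : edge_of (dart_rev d) = edge_of d.
Proof. by rewrite /edge_of dart_revK setUC. Qed.

Lemma edge_ofP (d d' : dart G) :
  (edge_of d == edge_of d') = (d == d') || (d == dart_rev d').
Proof.
apply/eqP/orP=> [E|[]/eqP-> //]; last by rewrite edge_of_rev.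
case: d d' E => [[x y] /= xy] [[a b] /= ab]; rewrite /edge_of /origin /= => E.
have /orP Hx : (x == a) || (x == b) by rewrite -in_set2 -E set21.
have /orP Hy : (y == a) || (y == b) by rewrite -in_set2 -E set22.
have Nxy : x != y by apply: contraTneq xy => ->; rewrite adj_irrefl.
rewrite -!val_eqE /= !xpair_eqE.
by case: Hx Nxy => /eqP->; case: Hy => /eqP->; rewrite ?eqxx; auto.
Qed.

Lemma dart_rev_neq (d : dart G) : dart_rev d != d.
Proof.
apply/eqP => /(congr1 (@origin G)) E; have := valP d.
by rewrite /= -[(sval d).2]/(origin (dart_rev d)) E adj_irrefl.
Qed.

(** This is the connectedness of the dual graph. Since [rot] is [phi] after reversal, [h] is
    constant around each vertex; reversal carries its value across an edge, and [G] is connected. *)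
Lemma face_edge_invariant_const (T : eqType) (h : dart G -> T) :
  (forall d, h (phi d) = h d) -> (forall d, h (dart_rev d) = h d) ->
  forall d d', h d = h d'.
Proof.
move=> hphi hrev.
have hrot d : h (rot d) = h d.
  by rewrite -[d in LHS]dart_revK -/(phi _) hphi hrev.
have horig d d' : origin d' = origin d -> h d = h d'.
  move/eqP; rewrite -rotationP => /porbitP[i ->].
  by elim: i => [|i IH]; rewrite ?expg0 ?perm1 // expgSr permM hrot.
move=> d d'; have /connectP[p] := plane_connected (origin d) (origin d').
elim: p d => [|y p IH] d /=; first by move=> _ /horig.
case/andP=> dy yp lp.
pose e : dart G := exist (fun p : G * G => adj p.1 p.2) (origin d, y) dy.
by rewrite (horig d e) // -hrev; apply: IH.
Qed.

Lemma adj_invariant_const (T : eqType) (h : G -> T) :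
  (forall x y, adj x y -> h x = h y) -> forall x y, h x = h y.
Proof.
move=> hadj x y; have /connectP[p] := plane_connected x y.
by elim: p x => [|z p IH] x /= => [_ ->//|/andP[/hadj-> /IH H /H]].
Qed.

(** The fiber of [edge_of] over an edge contains at most a dart and its reverse. *)
Lemma card_dart_leq : (#|dart G| <= 2 * #|edges G|)%N.
Proof.
rewrite -[leqLHS]sum1_card (partition_big edge_of [in edges G]) /=; last first.
  by move=> d _; exact: edge_of_mem.
rewrite mulnC -sum_nat_const; apply: leq_sum => e _; rewrite sum1_card.
case: (pickP [pred d | edge_of d == e]) => [d0 /= /eqP <-|/eq_card0-> //].
apply: (@leq_trans #|[set d0; dart_rev d0]|); last first.
  by rewrite cards2; case: (_ != _).
by apply/subset_leq_card/subsetP => d; rewrite !inE -edge_ofP.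
Qed.

(** A face is represented by the root of its [phi]-orbit, so that counting faces gives the [fcard]
    of Euler's formula. *)
Definition face_index : finType := {d : dart G | froots phi d}.
Definition edge_index : finType := {e : {set G} | e \in edges G}.

Lemma froot_root (d : dart G) : froots phi (froot phi d).
Proof. exact: roots_root (fconnect_sym face_step_inj) d. Qed.

Definition face_proj (d : dart G) : face_index := exist _ (froot phi d) (froot_root d).
Definition edge_proj (d : dart G) : edge_index := exist _ (edge_of d) (edge_of_mem d).

Lemma face_proj_eq (d d' : dart G) : (face_proj d == face_proj d') = fconnect phi d d'.
Proof. by rewrite -val_eqE (root_connect (fconnect_sym face_step_inj)). Qed.

Lemma edge_proj_eq (d d' : dart G) : (edge_proj d == edge_proj d') = (edge_of d == edge_of d').
Proof. by rewrite -val_eqE. Qed.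

Lemma face_proj_onto (f : face_index) : exists d, face_proj d = f.
Proof. by case: f => d fd; exists d; apply: val_inj; exact/eqP. Qed.

Lemma edge_proj_onto (e : edge_index) : exists d, edge_proj d = e.
Proof.
case: e => e he; have /imsetP[p] := he; rewrite inE => pe Ee.
by exists (exist (fun p : G * G => adj p.1 p.2) p pe); apply: val_inj; rewrite /= Ee.
Qed.

Lemma face_proj_step (d : dart G) : face_proj (phi d) = face_proj d.
Proof.
by apply/eqP; rewrite face_proj_eq (fconnect_sym face_step_inj) fconnect1.
Qed.

Lemma edge_proj_rev (d : dart G) : edge_proj (dart_rev d) = edge_proj d.
Proof. by apply/eqP; rewrite edge_proj_eq edge_of_rev. Qed.

(** * Cochains over F_2 and bipartiteness *)

Lemma addrr_F2 (a : 'F_2) : a + a = 0.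
Proof. by apply: addrr_pchar2; exact: pchar_Fp. Qed.

Lemma addr_F2_eq0 (a b : 'F_2) : a + b = 0 -> a = b.
Proof. by move=> ab; rewrite -[a]addr0 -(addrr_F2 b) addrA ab add0r. Qed.

(** As [s] permutes each fiber of [p], the two halves of the sum are equal and cancel in
    characteristic 2. *)
Lemma sum_fiber_coboundary (X : finType) (p : dart G -> X) (s : dart G -> dart G)
    (g : dart G -> 'F_2) (x : X) :
  injective s -> (forall d, p (s d) = p d) ->
  \sum_(d | p d == x) (g d + g (s d)) = 0.
Proof.
move=> s_inj ps; rewrite big_split /=.
rewrite [X in X + _](reindex_inj s_inj) /=.
rewrite (eq_bigl _ _ (fun d => congr1 (fun y => y == x) (ps d))).
exact: addrr_F2.
Qed.

Definition coboundary_mx : 'M['F_2]_(#|G|, #|dart G|) :=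
  fiber_mx _ (@origin G) + fiber_mx _ (fun d : dart G => origin (dart_rev d)).

(** Its transpose yields the sums over faces and over edges. Vanishing on an edge means agreeing on
    its two darts, so the edge block expresses symmetry. *)
Definition boundary_mx : 'M['F_2]_(#|face_index| + #|edge_index|, #|dart G|) :=
  col_mx (fiber_mx _ face_proj) (fiber_mx _ edge_proj).

Lemma mul_coboundary_mx (u : 'rV_#|G|) (d : dart G) :
  (u *m coboundary_mx) 0 (enum_rank d) =
    u 0 (enum_rank (origin d)) + u 0 (enum_rank (origin (dart_rev d))).
Proof. by rewrite mulmxDr mxE !mul_fiber_mx !enum_rankK. Qed.

Lemma coboundary_boundary : coboundary_mx *m boundary_mx^T = 0.
Proof.
rewrite tr_col_mx mul_mx_row -[RHS]row_mx0; congr row_mx; apply/matrixP => i j.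
  rewrite mul_fiber_mxT [RHS]mxE.
  (* The end of [d] is the origin of [phi d], which gives the summand the form [g d + g (phi d)]. *)
  under eq_bigr => d _ do rewrite !mxE !enum_rankK -origin_face_step.
  apply: (@sum_fiber_coboundary _ _ phi (fun d => (origin d == enum_val i)%:R)).
    exact: face_step_inj.
  exact: face_proj_step.
rewrite mul_fiber_mxT [RHS]mxE.
under eq_bigr => d _ do rewrite !mxE !enum_rankK.
apply: (@sum_fiber_coboundary _ _ (@dart_rev G) (fun d => (origin d == enum_val i)%:R)).
  exact: (can_inj dart_revK).
exact: edge_proj_rev.
Qed.

(** The sum over a face is its length, which is even; the sum over an edge counts its two darts. *)
Lemma one_cocycle : (const_mx 1 : 'rV['F_2]_#|dart G|) *m boundary_mx^T = 0.
Proof.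
rewrite tr_col_mx mul_mx_row -[RHS]row_mx0; congr row_mx; apply/matrixP => i j.
  rewrite mul_fiber_mxT [RHS]mxE.
  under eq_bigr => d _ do rewrite mxE.
  have [d0 <-] := face_proj_onto (enum_val j).
  under eq_bigl => d do rewrite eq_sym face_proj_eq.
  rewrite sumr_const -[#|_|]/(fingraph.order phi d0).
  have := even_faces d0; rewrite size_map size_orbit => /negPf ev.
  by rewrite -[fingraph.order _ _]odd_double_half ev add0n -addnn mulrnDr addrr_F2.
rewrite mul_fiber_mxT [RHS]mxE.
under eq_bigr => d _ do rewrite mxE.
have [d0 <-] := edge_proj_onto (enum_val j).
under eq_bigl => d do rewrite edge_proj_eq edge_ofP.
rewrite (bigD1 d0) ?eqxx //= (big_pred1 (dart_rev d0)) ?addrr_F2 // => d /=.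
have := dart_rev_neq d0; case: (eqVneq d d0) => [->|_]; rewrite ?andbT //.
by rewrite eq_sym => /negPf->.
Qed.

Lemma rank_coboundary (x0 : G) : (#|G| <= (\rank coboundary_mx).+1)%N.
Proof.
apply: (@mxrank_ker_line _ _ _ _ (const_mx 1)) => u /rowP uC.
apply/sub_rVP; exists (u 0 (enum_rank x0)); apply/rowP => j.
rewrite !mxE mulr1 -(enum_valK j).
apply: (adj_invariant_const (h := fun x => u 0 (enum_rank x))) => x y xy.
have := uC (enum_rank (exist _ (x, y) xy : dart G)).
by rewrite mul_coboundary_mx mxE => /addr_F2_eq0.
Qed.

(** A kernel vector is a pair of functions, on faces and on edges, with the same pullback to darts.
    This pullback is invariant under both [phi] and [dart_rev], hence constant. *)
Lemma rank_boundary (d0 : dart G) :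
  (#|face_index| + #|edge_index| <= (\rank boundary_mx).+1)%N.
Proof.
apply: (@mxrank_ker_line _ _ _ _ (const_mx 1)) => u.
rewrite -[u]hsubmxK; set u1 := lsubmx u; set u2 := rsubmx u.
rewrite mul_row_col => /rowP uM.
have uE d : u1 0 (enum_rank (face_proj d)) = u2 0 (enum_rank (edge_proj d)).
  have E := uM (enum_rank d).
  by apply: addr_F2_eq0; rewrite mxE !mul_fiber_mx !enum_rankK [RHS]mxE in E.
pose h d := u1 0 (enum_rank (face_proj d)).
have hc : forall d d', h d = h d'.
  apply: face_edge_invariant_const => d; first by rewrite /h face_proj_step.
  by rewrite /h !uE edge_proj_rev.
apply/sub_rVP; exists (h d0).
rewrite -row_mx_const scale_row_mx; congr row_mx; apply/rowP => j.
  rewrite [RHS]mxE [X in _ * X]mxE mulr1 -(enum_valK j).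
  by have [d <-] := face_proj_onto (enum_val j); exact: hc.
rewrite [RHS]mxE [X in _ * X]mxE mulr1 -(enum_valK j).
by have [d <-] := edge_proj_onto (enum_val j); rewrite -uE; exact: hc.
Qed.

(** By exactness the constant 1 is the coboundary of some [u]; the values of [u] at the ends of an
    edge then sum to 1, so [u] is a 2-coloring. *)
Lemma even_faces_bipartite :
  exists f : G -> bool, forall x y, adj x y -> f x != f y.
Proof.
case: (pickP (dart G)) => [d0 _|no_dart]; last first.
  by exists xpredT => x y xy; have := no_dart (exist _ (x, y) xy).
have /submxP[u uC] : ((const_mx 1 : 'rV['F_2]_#|dart G|) <= coboundary_mx)%MS.
  apply: exact_of_rank coboundary_boundary (rank_coboundary (origin d0))
    (rank_boundary d0) _ one_cocycle.
  (* Euler's formula gives [v + f + e = 2 * e + 2], and there are at most [2 * e] darts. *)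
  have dim v f e d : (d <= 2 * e -> v + f = e + 2 -> d + 2 <= v + (f + e))%N by lia.
  have -> : #|face_index| = fcard phi (dart G).
    by rewrite card_sig; apply: eq_card => d; rewrite !inE andbT.
  have -> : #|edge_index| = #|edges G| by rewrite card_sig; exact: eq_card.
  exact: dim card_dart_leq (plane_Euler G).
exists (fun x => u 0 (enum_rank x) == 0) => x y xy.
have /rowP/(_ (enum_rank (exist _ (x, y) xy : dart G))) := uC.
rewrite mul_coboundary_mx mxE /origin /=.
move: (u 0 _) (u 0 _) => a b.
by case: a b => [[|[|]] //= ?] [[|[|]] //= ?].
Qed.

End Bipartite.

(** * Independent sets in bipartite graphs *)

Lemma independent_leq_alpha (G : sgraph) (S : {set G}) :
  independent S -> (#|S| <= alpha G)%N.
Proof. exact: leq_bigmax_cond. Qed.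

Lemma bipartite_card_leq (G : sgraph) (f : G -> bool) :
  (forall x y, adj x y -> f x != f y) -> (#|G| <= 2 * alpha G)%N.
Proof.
move=> fP.
have ind b : independent [set x | f x == b].
  apply/forall_inP => x; rewrite inE => /eqP fx.
  apply/forall_inP => y; rewrite inE => /eqP fy.
  by apply: contraTN isT => /fP; rewrite fx fy eqxx.
rewrite -(cardsC [set x | f x == true]) mul2n -addnn leq_add //.
  exact: independent_leq_alpha.
rewrite (_ : ~: _ = [set x | f x == false]) ?independent_leq_alpha //.
by apply/setP => x; rewrite !inE; case: (f x).
Qed.

(** * Color classes of half-monochromatic colorings *)

Section Coloring.
Variables (G : plane_graph) (k : nat) (c : {ffun G -> 'I_k}).
Hypothesis c_proper : proper_coloring c.

Lemma proper_coloringP x y : adj x y -> c x != c y.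
Proof. by move: c_proper => /forallP/(_ x)/forallP/(_ y)/implyP. Qed.

Lemma count_color_pair (i : 'I_k) x y :
  adj x y -> ((c x == i) + (c y == i) <= 1)%N.
Proof.
move/proper_coloringP; case: (c x =P i) => [->|_]; last by rewrite leq_b1.
by rewrite eq_sym => /negPf->.
Qed.

(** Cut the path into consecutive adjacent pairs; by properness each pair contains the color at most
    once. *)
Lemma count_color_even_path (i : 'I_k) (s : seq G) :
  ~~ odd (size s) -> sorted (@adj G) s ->
  (count (fun x => c x == i) s <= (size s)./2)%N.
Proof.
have [n] := ubnP (size s); elim: n s => // n IH [|x [|y s]] //= /ltnSE lt_s.
rewrite negbK => ev /andP[xy ys]; rewrite addnA -add1n leq_add //.
  exact: count_color_pair.
by apply: IH => //; [lia|exact: path_sorted ys].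
Qed.

Lemma half_monochromatic_repeat (x y : G) :
    even_polygonal_faces G -> half_monochromatic c -> adj x y ->
  exists2 z, z \notin [:: x; y] & c z \in [:: c x; c y].
Proof.
move=> evG /forallP half xy; pose d : dart G := exist _ (x, y) xy.
have [/andP[sz /andP[cyc un]] ev] := evG d.
have /existsP[i hi] := half d.
have [s Es] : exists s, face_walk d = [:: x, y & s].
  move: sz; rewrite /face_walk /orbit size_map size_traject.
  case: (fingraph.order _ d) => [|[|n]] // _; rewrite /= origin_face_step.
  by eexists.
have cardE (a : pred G) : #|[set z in face_vertices d | a z]| = count a (face_walk d).
  rewrite -size_filter -(card_uniqP (filter_uniq a un)).
  by apply: eq_card => z; rewrite !inE mem_filter andbC.
have cardF : #|face_vertices d| = size (face_walk d).
  by rewrite cardsE; exact/card_uniqP.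
rewrite cardE cardF Es /= in hi; rewrite Es /= in sz ev cyc un.
rewrite rcons_path in cyc; case/and3P: cyc => _ ys _.
have le_xy := count_color_pair i xy.
have le_s : (count (fun z => c z == i) s <= (size s)./2)%N.
  by apply: count_color_even_path; [lia|exact: path_sorted ys].
(* A face with 2n vertices has at least n of color [i], while [x, y] supply at most 1 and [s] at
   most n - 1. Both bounds are attained, and n - 1 > 0 because n >= 2. *)
have [gt0_xy] : (0 < (c x == i) + (c y == i))%N /\ has (fun z => c z == i) s.
  rewrite has_count; move: hi le_xy le_s sz ev.
  by case: (c x == i); case: (c y == i); move: (count _ s) => /= m; lia.
case/hasP => z zs /eqP cz; exists z.
  apply: contraL zs; rewrite !inE => /orP[]/eqP->; case/and3P: un => //.
  by rewrite inE negb_or => /andP[].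
by move: gt0_xy; rewrite cz !inE ![i == _]eq_sym; case: (c x == i); case: (c y == i).
Qed.

Definition uniquely_colored : {set G} := [set x | #|[set y | c y == c x]| == 1%N].

Lemma uniquely_colored_independent :
  even_polygonal_faces G -> half_monochromatic c -> independent uniquely_colored.
Proof.
move=> evG half; apply/forall_inP => x; rewrite inE => /cards1P[x' Ex].
apply/forall_inP => y; rewrite inE => /cards1P[y' Ey].
apply/negP => /(half_monochromatic_repeat evG half)[z].
rewrite !inE negb_or => /andP[zx zy].
have /set1P Ex' : x \in [set x'] by rewrite -Ex inE.
have /set1P Ey' : y \in [set y'] by rewrite -Ey inE.
case/orP => cz.
  by move: zx; rewrite Ex' -in_set1 -Ex inE cz.
by move: zy; rewrite Ey' -in_set1 -Ey inE cz.
Qed.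

(** For each color, 2 is at most the size of its class plus 1 if the class is a singleton; sum over
    all colors. *)
Lemma double_colors_leq :
  uses_all_colors c -> (2 * k <= #|G| + #|uniquely_colored|)%N.
Proof.
move/forallP => all_c.
pose single i := #|[set y | c y == i]| == 1%N.
have cardG : (\sum_(i < k) #|[set y | c y == i]| = #|G|)%N.
  rewrite -[RHS]sum1_card (partition_big c predT) //=.
  by apply: eq_bigr => i _; rewrite -sum1_card; apply: eq_bigl => x; rewrite inE.
(* [c] maps the uniquely colored vertices onto the colors with a singleton class. *)
have card_single : (\sum_(i < k) single i <= #|uniquely_colored|)%N.
  rewrite -big_mkcond /= sum1_card.
  apply: leq_trans (leq_imset_card c uniquely_colored).
  apply/subset_leq_card/subsetP => i si; apply/imsetP.
  by have /existsP[x /eqP cx] := all_c i; exists x; rewrite ?inE cx.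
rewrite -cardG; apply: leq_trans (leq_add (leqnn _) card_single).
rewrite -big_split mulnC -[k in (k * _)%N]card_ord -sum_nat_const /=.
apply: leq_sum => i _; have /existsP[x cx] := all_c i.
have : (0 < #|[set y | c y == i]|)%N by apply/card_gt0P; exists x; rewrite inE.
by rewrite /single; case: #|_| => [|[|]].
Qed.

End Coloring.

Theorem theorem1p1 (G : plane_graph) (hG : even_polygonal_faces G) :
  (chi_f G)%:R <= (3%:R / 2%:R) * (alpha G)%:R :> rat.
Proof.
have cardG : (#|G| <= 2 * alpha G)%N.
  have [f fP] := even_faces_bipartite (fun d => proj2 (hG d)).
  exact: bipartite_card_leq fP.
have : (2 * chi_f G <= 3 * alpha G)%N.
  (* Halving isolates [chi_f G], so that the maximum can be bounded one [k] at a time. *)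
  suff : (chi_f G <= (3 * alpha G)./2)%N by lia.
  apply/bigmax_leqP => k /existsP[c /and3P[c_proper c_all c_half]].
  have := double_colors_leq c_all.
  have := independent_leq_alpha (uniquely_colored_independent c_proper hG c_half).
  by lia.
by rewrite -(ler_nat rat) !natrM; lra.
Qed.
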